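(* Let $G$ be an abelian group. Then: (a) $\widetilde{s}(G)=0$ if and only if $t_p(G)$ is finite for every prime $p$ and $G/t(G)$ is a torsion-free group of torsion-free rank $\leq 1$ such that no infinity appears in its type; (b) $\widetilde{ns}(G)=0$ if and only if $r_p(G)$ is finite for every prime $p$ and $G/t(G)$ is a torsion-free group of torsion-free rank $\leq 1$ such that no infinity appears in its type; (c) $\widetilde{s_0}(G)=0$ if and only if $t_p(G)$ is finite for every prime $p$ and $r_0(G)$ is finite.
   Context: $\mathbb N=\{0,1,2,\dots\}$ and $\mathbb N_+=\mathbb N\setminus\{0\}$. Let $\phi$ be an endomorphism of an abelian group $G$. A string of $\phi$ is a sequence $S=\{x_n\}_{n\in\mathbb N}$ of pairwise distinct elements of $G$ such that $\phi(x_n)=x_{n-1}$ for every $n\in\mathbb N_+$. A string is singular if $\phi^j(x_0)=\phi^k(x_0)$ for some $j\neq k$ in $\mathbb N$, and non-singular otherwise; it is a null string if $x_0\neq 0$ and $\phi^k(x_0)=0$ for some $k\in\mathbb N_+$. Define $s(\phi)$ (respectively $ns(\phi)$, $s_0(\phi)$) as the supremum of the cardinalities $|\mathcal F|$, where $\mathcal F$ ranges over the families of pairwise disjoint strings (respectively non-singular strings, null strings) of $\phi$; if this supremum is infinite it is set equal to the symbol $\infty$. For an abelian group $G$, $s(G)=\sup\{s(\phi):\phi\in\mathrm{End}(G)\}$, $ns(G)=\sup\{ns(\phi):\phi\in\mathrm{End}(G)\}$, $s_0(G)=\sup\{s_0(\phi):\phi\in\mathrm{End}(G)\}$. The hereditary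 string numbers are $\widetilde s(G)=\sup\{s(H):H\leq G\}$, $\widetilde{ns}(G)=\sup\{ns(H):H\leq G\}$, $\widetilde{s_0}(G)=\sup\{s_0(H):H\leq G\}$, where $H$ ranges over all subgroups of $G$. $t(G)$ is the torsion subgroup, $t_p(G)$ the $p$-component, $r_0(G)$ the torsion-free rank, and $r_p(G)=\dim_{\mathbb F_p}G[p]$ the $p$-rank of $G$, where $G[p]=\{x\in G:px=0\}$. For a torsion-free abelian group $A$ of rank $1$ and $0\neq x\in A$, the $p$-height of $x$ is $h_p(x)=\sup\{n\in\mathbb N:x\in p^nA\}\in\mathbb N\cup\{\infty\}$, and the type of $A$ is the class of the sequence $(h_p(x))_p$ modulo changing finitely many finite entries to other finite values (it does not depend on $x$); infinity appears in the type of $A$ if $h_p(x)=\infty$ for some prime $p$. For the trivial group (rank $0$) the condition that no infinity appears in the type is vacuous. *)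

(* Defs.v *)
From HB Require Import structures.
From mathcomp Require Import all_boot all_order all_algebra ring_quotient.
From mathcomp Require Import boolp classical_sets functions cardinality.
From mathcomp Require Import reals ereal constructive_ereal counting_measure.
From mathcomp Require Import Rstruct.

Set Implicit Arguments.
Unset Strict Implicit.
Unset Printing Implicit Defensive.

Import Order.TTheory GRing.Theory Num.Theory.
Local Open Scope classical_set_scope.
Local Open Scope ring_scope.

(* String numbers, ranks and heights live in N together with oo; they are
   represented in the extended reals, where ereal_sup provides all suprema and
   [counting X] is the number of elements of X, or +oo when X is infinite.
   Every supremum below is over a nonempty set of elements of [0, +oo]
   (independent sets and families of strings may be empty), so the value -oo
   of ereal_sup on the empty set never occurs. *)
Notation xnat := (\bar Rdefinitions.R).
Definition xcard (T : choiceType) (X : set T) : xnat := counting X.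

Section Subgroups.
Variable G : zmodType.

(* A zmodClosed G is a boolean predicate closed under the group operations;
   boolp makes every Prop-valued one of this form. *)
Record subgroup (H : zmodClosed G) : Type := Subgroup {
  subgroup_val : G;
  _ : subgroup_val \in H
}.

HB.instance Definition _ (H : zmodClosed G) := [isSub for @subgroup_val H].
HB.instance Definition _ (H : zmodClosed G) := [Choice of subgroup H by <:].
HB.instance Definition _ (H : zmodClosed G) :=
  [SubChoice_isSubZmodule of subgroup H by <:].

Definition torsion : {pred G} :=
  fun x => `[< exists2 n : nat, (0 < n)%N & x *+ n = 0 >].

Lemma torsion_zmod_closed : zmod_closed torsion.
Proof.
split=> [|x y /asboolP[m m0 xm] /asboolP[n n0 yn]]; apply/asboolP.
  by exists 1%N.
exists (m * n)%N; first by rewrite muln_gt0 m0.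
by rewrite mulrnBl mulrnA xm mul0rn mulnC mulrnA yn mul0rn subrr.
Qed.

HB.instance Definition _ := GRing.isZmodClosed.Build G torsion
  torsion_zmod_closed.

Definition p_component (p : nat) : set G :=
  [set x | exists k : nat, x *+ p ^ k = 0].

Definition torsion_free : Prop :=
  forall (x : G) (n : nat), (0 < n)%N -> x *+ n = 0 -> x = 0.

End Subgroups.

Arguments subgroup {G} H.
Arguments torsion G : clear implicits.
Arguments p_component G p : clear implicits.

Section Ranks.
Variable G : zmodType.

Definition Z_independent (X : set G) : Prop :=
  forall (s : seq G) (c : G -> int), uniq s -> [set` s] `<=` X ->
    \sum_(x <- s) x *~ c x = 0 -> forall x, x \in s -> c x = 0.

Definition rank0 : xnat := ereal_sup [set xcard X | X in Z_independent].

(* A linearly independent subset of the F_p-vector space G[p], for p prime; a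
   scalar in 'F_p acts through its representative in {0, .., p - 1}. *)
Definition Fp_independent (p : nat) (X : set G) : Prop :=
  X `<=` [set x | x *+ p = 0] /\
  forall (s : seq G) (c : G -> 'F_p), uniq s -> [set` s] `<=` X ->
    \sum_(x <- s) x *+ c x = 0 -> forall x, x \in s -> c x = 0.

Definition rankp (p : nat) : xnat :=
  ereal_sup [set xcard X | X in Fp_independent p].

End Ranks.

Section Types.
Variable A : zmodType.

Definition height (p : nat) (x : A) : xnat :=
  ereal_sup [set n%:R%:E | n in [set n : nat | exists y : A, x = y *+ p ^ n]].

(* For A torsion-free of rank 1 the choice of x is irrelevant; for A trivial
   there is no x. *)
Definition infinity_in_type : Prop :=
  exists2 x : A, x != 0 & exists2 p : nat, prime p & height p x = +oo%E.

(* A is torsion-free of rank at most 1 with no infinity in its type. *)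
Definition rank_le1_no_infinity : Prop :=
  [/\ torsion_free A, (rank0 A <= 1)%E & ~ infinity_in_type].

End Types.

Section Strings.
Variables (G : zmodType) (phi : G -> G).

Definition is_string (x : nat -> G) : Prop :=
  injective x /\ forall n : nat, phi (x n.+1) = x n.

Definition singular (x : nat -> G) : Prop :=
  exists j k : nat, j <> k /\ iter j phi (x 0%N) = iter k phi (x 0%N).

Definition nonsingular_string (x : nat -> G) : Prop :=
  is_string x /\ ~ singular x.

Definition null_string (x : nat -> G) : Prop :=
  [/\ is_string x, x 0%N <> 0
    & exists2 k : nat, (0 < k)%N & iter k phi (x 0%N) = 0].

End Strings.

Definition disjoint_family (G : Type) (P : set (nat -> G))
    (F : set (nat -> G)) : Prop :=
  F `<=` P /\ trivIset F (fun x => range x).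

Definition max_disjoint (G : zmodType) (P : set (nat -> G)) : xnat :=
  ereal_sup [set xcard F | F in disjoint_family P].

Section StringNumbers.
Variable G : zmodType.

Definition s_end (phi : G -> G) : xnat := max_disjoint (is_string phi).
Definition ns_end (phi : G -> G) : xnat :=
  max_disjoint (nonsingular_string phi).
Definition s0_end (phi : G -> G) : xnat := max_disjoint (null_string phi).

Definition s_grp : xnat :=
  ereal_sup (range (fun f : {additive G -> G} => s_end f)).
Definition ns_grp : xnat :=
  ereal_sup (range (fun f : {additive G -> G} => ns_end f)).
Definition s0_grp : xnat :=
  ereal_sup (range (fun f : {additive G -> G} => s0_end f)).

End StringNumbers.

Section HereditaryStringNumbers.
Variable G : zmodType.

Definition s_her : xnat :=
  ereal_sup (range (fun H : zmodClosed G => s_grp (subgroup H))).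
Definition ns_her : xnat :=
  ereal_sup (range (fun H : zmodClosed G => ns_grp (subgroup H))).
Definition s0_her : xnat :=
  ereal_sup (range (fun H : zmodClosed G => s0_grp (subgroup H))).

End HereditaryStringNumbers.

(* Main.v *)
From HB Require Import structures.
Require Import Defs.
From mathcomp Require Import all_boot all_order all_algebra.
From mathcomp Require Import boolp classical_sets cardinality.
From mathcomp Require Import ereal counting_measure.
From mathcomp Require Import Rstruct finmap zify.

Set Implicit Arguments.
Unset Strict Implicit.
Unset Printing Implicit Defensive.

Import Order.TTheory GRing.Theory Num.Theory.
Local Open Scope classical_set_scope.
Local Open Scope ring_scope.

(** A hereditary string number vanishes exactly when no subgroup of [G] carries
    an endomorphism with a string of the given kind; equivalently, when no
    group embedded in [G] does ([hereditary_number_eq0P]).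

    Strings are produced as follows.  If [G[p]] is infinite, it contains a
    vector space over [F_p] of countable dimension, with its unilateral shift
    (null strings) and its bilateral shift (non-singular strings).  If [G[p]] is
    finite, then [p ^ N t(G)] is divisible by [p] for large [N]
    ([finite_socle_divisible]); so when [t_p(G)] is infinite, the multiplication
    by [p] has a null string.  The same divisibility lifts a divisible element
    of [G/t(G)] to a backward orbit of the multiplication by [p] in [G]
    ([infinite_height_nonsingular]), which accounts for infinite heights.  Two
    elements independent modulo torsion span a copy of [Z^2], which has a
    unipotent automorphism of infinite order.  Infinite torsion-free rank yields
    a free subgroup of countable rank, with its unilateral shift.

    Conversely, let [x] be a string of [f].  On a torsion-free group of rank at
    most one, [f] is the multiplication by a fraction [a / b], and a prime
    factor of [a] or of [b] would create an infinite height.  Hence, if no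
    infinite height exists, [x n] and [x (n+2)] agree modulo torsion
    ([string_period_torsion]).  The torsion error has bounded order along the
    forward orbit, so finite socles make this orbit finite and the string
    singular.  If the components [t_p(G)] are finite, no backward orbit of
    torsion elements starts at [0] unless it vanishes
    ([torsion_backward_eq0]); the error then has bounded order along the
    backward orbit as well, and [x] takes a value twice.  The same lemma shows
    that a null string must leave the torsion subgroup; from there on it is a
    triangular, hence independent, sequence and the torsion-free rank is
    infinite ([triangular_rank0]). *)

(** * Cardinals and suprema *)

Lemma xcard_ge0 (T : choiceType) (X : set T) : (0 <= xcard X)%E.
Proof. by rewrite /xcard /counting; case: ifP => // _; rewrite lee_fin. Qed.

Lemma xcard_infinite (T : choiceType) (X : set T) :
  infinite_set X -> xcard X = +oo%E.
Proof. by move=> infX; rewrite /xcard /counting asboolF. Qed.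

Lemma xcard_finite (T : choiceType) (X : set T) :
  finite_set X -> (xcard X < +oo)%E.
Proof. by move=> finX; rewrite /xcard /counting asboolT // ltry. Qed.

Lemma lt_xcardP (T : choiceType) (X : set T) (n : nat) :
  (n%:R%:E < xcard X)%E <->
  exists s : seq T, [/\ uniq s, size s = n.+1 & [set` s] `<=` X].
Proof.
split=> [|[s [us ss sX]]].
  suff: (n%:R%:E < xcard X)%E -> exists2 B : {fset T}, [set` B] `<=` X & (n <
    #|` B|)%N.
    move=> /[apply] -[B BX nB]; exists (take n.+1 B); split.
    - exact/take_uniq/fset_uniq.
    - by rewrite size_take_min; apply/minn_idPl.
    - by move=> x /mem_take; exact: BX.
  have [finX|/(infinite_set_fset n.+1)//] := pselect (finite_set X).
  rewrite /xcard /counting asboolT // lte_fin ltr_nat => nX.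
  by exists (fset_set X) => //; rewrite fset_setK.
have [finX|infX] := pselect (finite_set X);
  last by rewrite xcard_infinite ?ltry.
rewrite /xcard /counting asboolT // lte_fin ltr_nat -ss.
have <- : #|` [fset x in s]%fset| = size s by rewrite card_fseq undup_id.
apply/fsubset_leq_card/fsubsetP => x; rewrite !inE in_fset_set // => xs.
exact/mem_set/sX.
Qed.

Lemma ereal_sup_eq0P (S : set xnat) : S !=set0 -> (forall y, S y -> (0 <= y)%E)
  ->
  ereal_sup S = 0%E <-> forall y, S y -> y = 0%E.
Proof.
move=> [z Sz] S0; split=> [sup0 y Sy|allS0].
  apply/eqP; rewrite eq_le S0 // andbT -sup0.
  by apply: le_ereal_sup_tmp; exists y.
apply/eqP; rewrite eq_le; apply/andP; split.
  by apply: ge_ereal_sup => y /allS0 ->.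
by apply: le_ereal_sup_tmp; exists z; rewrite // S0.
Qed.

(** * Hereditary string numbers and embedded endomorphisms *)

Lemma max_disjoint_ge0 (G : zmodType) (P : set (nat -> G)) :
  (0 <= max_disjoint P)%E.
Proof.
apply: le_ereal_sup_tmp; exists (xcard (set0 : set (nat -> G)));
  last exact: xcard_ge0.
by exists set0 => //; split=> // i j [].
Qed.

Lemma max_disjoint_eq0P (G : zmodType) (P : set (nat -> G)) :
  max_disjoint P = 0%E <-> forall x, ~ P x.
Proof.
rewrite /max_disjoint ereal_sup_eq0P; last 2 first.
- by exists (xcard (set0 : set (nat -> G))), set0 => //; split=> // i j [].
- by move=> _ [F _ <-]; exact: xcard_ge0.
split=> [all0 x Px|noP _ [F [FP _] <-]].
  have /all0 : [set xcard F | F in disjoint_family P] (xcard [set x]).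
    exists [set x] => //; split=> [_ ->//|y z -> -> //].
  suff /[swap] -> : (0%:R%:E < xcard [set x])%E by rewrite ltxx.
  by apply/lt_xcardP; exists [:: x]; split=> // y /=; rewrite inE => /eqP.
apply/eqP; rewrite eq_le xcard_ge0 andbT leNgt; apply/negP.
move=> /(lt_xcardP _ 0)[[|x s] [_ // _ sF]].
by apply: (noP x); apply/FP/sF; rewrite /= mem_head.
Qed.

(** Under this condition a subgroup of [G] can be replaced by any isomorphic
    group. *)
Definition embedding_stable
    (P : forall M : zmodType, (M -> M) -> set (nat -> M)) : Prop :=
  forall (M N : zmodType) (f : M -> M) (g : N -> N) (j : {additive M -> N}),
    injective j -> (forall m, g (j m) = j (f m)) ->
  forall x, P M f x -> P N g (j \o x).

Section Hereditary.
Variables (P : forall M : zmodType, (M -> M) -> set (nat -> M)).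
Hypothesis Pstable : embedding_stable P.
Variable G : zmodType.

(** The common form of [s_her], [ns_her] and [s0_her]. *)
Definition hereditary_number : xnat :=
  ereal_sup (range (fun H : zmodClosed G =>
    ereal_sup (range (fun f : {additive subgroup H -> subgroup H} =>
      max_disjoint (P f))))).

Lemma hereditary_number_eq0_subgroup :
  hereditary_number = 0%E <->
  forall (H : zmodClosed G) (f : {additive subgroup H -> subgroup H}) x,
    ~ P f x.
Proof.
have inner (H : zmodClosed G) : ereal_sup (range
      (fun f : {additive subgroup H -> subgroup H} => max_disjoint (P f))) = 0%E
    <-> forall (f : {additive subgroup H -> subgroup H}) x, ~ P f x.
  rewrite ereal_sup_eq0P; last 2 first.
  - by exists (max_disjoint (P (\0%R : {additive subgroup H -> subgroup H}))),
    \0%R.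
  - by move=> _ [f _ <-]; exact: max_disjoint_ge0.
  split=> [all0 f|noP _ [f _ <-]]; last exact/max_disjoint_eq0P.
  by apply/max_disjoint_eq0P/all0; exists f.
pose tG : zmodClosed G := torsion G.
rewrite /hereditary_number ereal_sup_eq0P; last 2 first.
- by exists (ereal_sup (range (fun f : {additive subgroup tG -> subgroup tG} =>
    max_disjoint (P f)))), tG.
- move=> _ [H _ <-]; apply: le_ereal_sup_tmp.
  exists (max_disjoint (P (\0%R : {additive subgroup H -> subgroup H})));
    last exact: max_disjoint_ge0.
  by exists \0%R.
split=> [all0 H|noP _ [H _ <-]]; last by apply/inner => f x; exact: noP.
by apply/inner/all0; exists H.
Qed.

Section Image.
Variables (M : zmodType) (i : {additive M -> G}).
Hypothesis i_inj : injective i.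

Definition image_pred : {pred G} := fun y => `[< exists x, i x = y >].

Lemma image_pred_closed : zmod_closed image_pred.
Proof.
split=> [|_ _ /asboolP[x <-] /asboolP[y <-]]; apply/asboolP.
  by exists 0; rewrite raddf0.
by exists (x - y); rewrite raddfB.
Qed.

HB.instance Definition _ := GRing.isZmodClosed.Build G image_pred
  image_pred_closed.

Fact to_image_subproof m : i m \in (image_pred : zmodClosed G).
Proof. by apply/asboolP; exists m. Qed.

Definition to_image (m : M) : subgroup image_pred := Subgroup
  (to_image_subproof m).

Fact of_image_subproof (y : subgroup image_pred) : exists m, i m == val y.
Proof. by case: y => y /= /asboolP[m <-]; exists m. Qed.

Definition of_image (y : subgroup image_pred) : M := xchoose (of_image_subproof
  y).

Lemma of_imageK : cancel of_image to_image.
Proof. by move=> y; apply/val_inj;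
  exact/eqP/(xchooseP (of_image_subproof y)). Qed.

Lemma to_image_inj : injective to_image.
Proof. by move=> x y /(congr1 val); exact: i_inj. Qed.

Lemma to_image_zmod_morphism : zmod_morphism to_image.
Proof. by move=> x y; apply/val_inj; exact: raddfB. Qed.

HB.instance Definition _ := GRing.isZmodMorphism.Build _ _ to_image
  to_image_zmod_morphism.

Variable f : {additive M -> M}.

Definition image_endo (y : subgroup image_pred) := to_image (f (of_image y)).

Lemma image_endoE m : image_endo (to_image m) = to_image (f m).
Proof. by congr (to_image (f _)); apply: to_image_inj; rewrite of_imageK. Qed.

Lemma image_endo_zmod_morphism : zmod_morphism image_endo.
Proof.
move=> x y; rewrite -(of_imageK x) -(of_imageK y) -raddfB !image_endoE.
by rewrite !raddfB.
Qed.

HB.instance Definition _ := GRing.isZmodMorphism.Build _ _ image_endo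
  image_endo_zmod_morphism.

End Image.

(** Up to isomorphism, this describes the subgroups of [G] having an
    endomorphism with a string of the given kind; it allows strings to be
    exhibited in convenient models (polynomials, pairs of integers, [G]
    itself). *)
Definition embedded : Prop :=
  exists (M : zmodType) (i : {additive M -> G}) (f : {additive M -> M})
    (x : nat -> M), injective i /\ P f x.

Lemma hereditary_number_eq0P : hereditary_number = 0%E <-> ~ embedded.
Proof.
rewrite hereditary_number_eq0_subgroup; split.
  move=> noP [M [i [f [x [i_inj Px]]]]].
  apply: (noP _ (image_endo (i := i) f) (to_image i \o x)).
  by apply: Pstable Px; [exact: to_image_inj|exact: image_endoE].
move=> noP H f x Px; apply: noP; exists (subgroup H), val, f, x.
by split=> //; exact: val_inj.
Qed.

End Hereditary.

Lemma iter_intertwine (M N : Type) (f : M -> M) (g : N -> N) (j : M -> N) n m :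
  (forall m, g (j m) = j (f m)) -> iter n g (j m) = j (iter n f m).
Proof. by move=> gj; elim: n => //= n ->. Qed.

Lemma is_string_stable : embedding_stable is_string.
Proof.
move=> M N f g j j_inj gj x [x_inj fx]; split=> [a b /j_inj/x_inj//|n].
by rewrite /= gj fx.
Qed.

Lemma nonsingular_string_stable : embedding_stable nonsingular_string.
Proof.
move=> M N f g j j_inj gj x [xS nsing]; split.
  exact: (is_string_stable j_inj gj).
move=> [a [b [ab]]]; rewrite /= !(iter_intertwine _ _ gj) => /j_inj eab.
by apply: nsing; exists a, b.
Qed.

Lemma null_string_stable : embedding_stable null_string.
Proof.
move=> M N f g j j_inj gj x [xS x0 [k k0 kx]]; split.
- exact: (is_string_stable j_inj gj).
- by rewrite /= -(raddf0 j) => /j_inj.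
- by exists k => //; rewrite /= (iter_intertwine _ _ gj) kx raddf0.
Qed.

(** * Torsion and the torsion-free quotient *)

Lemma torsionP (G : zmodType) (x : G) :
  reflect (exists2 n : nat, (0 < n)%N & x *+ n = 0) (x \in torsion G).
Proof. exact: asboolP. Qed.

Lemma torsion_raddf (M G : zmodType) (i : {additive M -> G}) (x : M) :
  injective i -> (i x \in torsion G) = (x \in torsion M).
Proof.
move=> i_inj; apply/torsionP/torsionP => -[n n0 xn]; exists n => //.
  by apply: i_inj; rewrite raddfMn xn raddf0.
by rewrite -raddfMn xn raddf0.
Qed.

Lemma raddf_torsion (M G : zmodType) (f : {additive M -> G}) (x : M) :
  x \in torsion M -> f x \in torsion G.
Proof. by move=> /torsionP[n n0 xn]; apply/torsionP; exists n => //;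
  rewrite -raddfMn xn raddf0. Qed.

Lemma torsionMn (G : zmodType) (x : G) n :
  (0 < n)%N -> (x *+ n \in torsion G) = (x \in torsion G).
Proof.
move=> n0; apply/idP/idP => [/torsionP[m m0 xnm]|]; last exact: rpredMn.
by apply/torsionP; exists (n * m)%N; rewrite ?muln_gt0 ?n0 // mulrnA.
Qed.

Lemma torsionMz (G : zmodType) (x : G) (c : int) :
  c != 0 -> (x *~ c \in torsion G) = (x \in torsion G).
Proof.
by case: c => n c0; rewrite ?NegzE ?mulrNz ?rpredN -?pmulrn torsionMn // lt0n.
Qed.

Lemma torsion_freeMz (A : zmodType) (x : A) (c : int) :
  torsion_free A -> c != 0 -> x *~ c = 0 -> x = 0.
Proof.
move=> tfA c0 xc0; have : x \in torsion A by rewrite -(torsionMz x c0) xc0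
  rpred0.
by move=> /torsionP[n]; exact: tfA.
Qed.

Section TorsionFreeQuotient.

Definition modt (G : zmodType) : zmodType := Quotient.quot (torsion G).

Definition to_modt (G : zmodType) : {additive G -> modt G} :=
  (\pi_(modt G))%qT : {additive G -> Quotient.quot (torsion G)}.

Lemma to_modt_eq0 (G : zmodType) (x : G) :
  (to_modt G x == 0) = (x \in torsion G).
Proof.
by rewrite -(raddf0 (to_modt G)) -[x in RHS]subr0 Quotient.idealrBE.
Qed.

Lemma to_modt_surj (G : zmodType) (a : modt G) : exists x, to_modt G x = a.
Proof. by exists (repr a); exact: reprK. Qed.

Lemma modt_torsion_free (G : zmodType) : torsion_free (modt G).
Proof.
move=> a n n0; have [x <-] := to_modt_surj a; rewrite -raddfMn => /eqP.
by rewrite !to_modt_eq0 torsionMn // -to_modt_eq0 => /eqP.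
Qed.

Variables (M N : zmodType) (h : {additive M -> N}).

Definition modt_map (a : modt M) : modt N := to_modt N (h (repr a)).

Lemma modt_mapE x : modt_map (to_modt M x) = to_modt N (h x).
Proof.
apply/eqP; rewrite -subr_eq0 -!raddfB to_modt_eq0; apply: raddf_torsion.
by rewrite -to_modt_eq0 raddfB subr_eq0; apply/eqP; exact: reprK.
Qed.

Lemma modt_map_zmod_morphism : zmod_morphism modt_map.
Proof.
move=> a b; have [x <-] := to_modt_surj a; have [y <-] := to_modt_surj b.
by rewrite -raddfB !modt_mapE !raddfB.
Qed.

HB.instance Definition _ := GRing.isZmodMorphism.Build _ _ modt_map
  modt_map_zmod_morphism.

Lemma modt_map_inj : injective h -> injective modt_map.
Proof.
move=> h_inj; apply: raddf_inj => a; have [x <-] := to_modt_surj a.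
by rewrite /= modt_mapE => /eqP;
  rewrite to_modt_eq0 torsion_raddf // -to_modt_eq0 => /eqP.
Qed.

End TorsionFreeQuotient.

(** * Rank at most one and infinite heights, elementwise *)

Definition pairwise_dependent (A : zmodType) : Prop :=
  forall u v : A, exists2 c : int * int, c != 0 & u *~ c.1 + v *~ c.2 = 0.

Lemma rank0_le1P (A : zmodType) : (rank0 A <= 1)%E <-> pairwise_dependent A.
Proof.
split=> [rk1 u v|depA].
  apply: contrapT => nodep; move: rk1; apply/negP; rewrite -ltNge.
  have indep c d : u *~ c + v *~ d = 0 -> c = 0 /\ d = 0.
    move=> uv0; apply: contrapT => cd; apply: nodep; exists (c, d) => //.
    by apply/eqP => -[c0 d0]; apply: cd.
  have uv : u != v.
    by apply/eqP => uv; have /indep[] : u *~ 1 + v *~ (- 1) = 0 by rewrite uv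
      mulrNz subrr.
  apply: (@lt_le_trans _ _ (xcard [set` [:: u; v]])).
    by apply/(lt_xcardP _ 1); exists [:: u; v]; split; rewrite /= ?inE ?uv.
  apply: le_ereal_sup_tmp; exists (xcard [set` [:: u; v]]) => //.
  exists [set` [:: u; v]] => // s c us suv sum0.
  (* s may miss u or v: extend the coefficients by zero *)
  have : u *~ (if u \in s then c u else 0) + v *~ (if v \in s then c v else 0)
    = 0.
    rewrite -[RHS]sum0.
    have -> : \sum_(x <- s) x *~ c x = \sum_(x <- [:: u; v] | x \in s) x *~ c x.
      rewrite -[RHS]big_filter; apply: perm_big; apply: uniq_perm => //.
        by rewrite filter_uniq //= inE uv.
      move=> x; rewrite mem_filter; case xs: (x \in s) => //=.
      by rewrite (suv x xs).
    rewrite !big_cons big_nil; do 2![case: ifP => _];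
      rewrite ?mulr0z ?addr0 ?add0r //.
  move=> /indep[cu cv] x xs; move: (suv x xs) (xs) => /=; rewrite !inE.
  by case/orP => /eqP -> s_; [rewrite s_ in cu|rewrite s_ in cv].
rewrite leNgt; apply/negP => /ereal_sup_gt[_ [X Xind <-]].
move=> /(lt_xcardP _ 1)[[|u [|v [|? ?]]] [us // _ sX]].
have [[c d] /= cd0 uv0] := depA u v.
move: us; rewrite /= inE andbT => uv.
have coefs := Xind [:: u; v] (fun w => if w == u then c else d) _ sX _.
have {coefs} cf : forall w, w \in [:: u; v] -> (if w == u then c else d) = 0.
  by apply: coefs; rewrite ?big_cons ?big_nil /= ?inE ?uv // eqxx eq_sym (negPf
    uv) addr0.
have := cf u; have := cf v; rewrite eq_sym (negPf uv) eqxx !inE !eqxx orbT.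
by move=> d0 c0; move: cd0; rewrite d0 // c0 // eqxx.
Qed.

Definition infinite_height (A : zmodType) (p : nat) (x : A) : Prop :=
  forall n : nat, exists y : A, x = y *+ p ^ n.

Lemma heightP (A : zmodType) (p : nat) (x : A) :
  height p x = +oo%E <-> infinite_height p x.
Proof.
split=> [hx n|hx].
  have : (n%:R%:E < height p x)%E by rewrite hx ltry.
  move=> /ereal_sup_gt[_ [m [y ->] <-]]; rewrite lte_fin ltr_nat => nm.
  by exists (y *+ p ^ (m - n)); rewrite -mulrnA -expnD subnK // ltnW.
apply: eq_infty => r; apply: le_ereal_sup_tmp.
exists ((Num.truncn `|r|).+1%:R%:E).
  by exists (Num.truncn `|r|).+1 => //; exact: hx.
rewrite lee_fin (le_trans (ler_norm r)) // ltW //; exact: truncnS_gt.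
Qed.

Definition no_infinite_height (A : zmodType) : Prop :=
  forall (p : nat) (x : A), prime p -> infinite_height p x -> x = 0.

Lemma rank_le1_no_infinityP (A : zmodType) : torsion_free A ->
  rank_le1_no_infinity A <-> pairwise_dependent A /\ no_infinite_height A.
Proof.
move=> tfA; split=> [[_ rk1 noinf]|[depA noinf]].
  split=> [|p x pp hx]; first exact/rank0_le1P.
  apply: contrapT => x0; apply: noinf; exists x; first exact/eqP.
  by exists p => //; apply/heightP.
split=> //; first exact/rank0_le1P.
by move=> [x x0 [p pp /heightP hx]]; move: x0; rewrite (noinf p x) // eqxx.
Qed.

Lemma pairwise_dependent_inj (A B : zmodType) (j : {additive A -> B}) :
  injective j -> pairwise_dependent B -> pairwise_dependent A.
Proof.
move=> j_inj depB u v; have [c c0 uv] := depB (j u) (j v); exists c => //.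
by apply: j_inj; rewrite raddfD !raddfMz raddf0.
Qed.

Lemma no_infinite_height_inj (A B : zmodType) (j : {additive A -> B}) :
  injective j -> no_infinite_height B -> no_infinite_height A.
Proof.
move=> j_inj noinf p x pp hx; apply: j_inj; rewrite raddf0.
apply: (noinf p) => // n; have [y ->] := hx n.
by exists (j y); rewrite raddfMn.
Qed.

(** * Orbits *)

Lemma finite_repetition (T : Type) (A : set T) (u : nat -> T) :
  finite_set A -> (forall n, A (u n)) -> exists i j, (i < j)%N /\ u i = u j.
Proof.
move=> finA Au; apply: contrapT => norep; apply: infinite_nat.
have -> : [set: nat] = u @^-1` A by apply/seteqP; split=> n _; first exact: Au.
apply: finite_preimage => // i j _ _ uij; apply/eqP; rewrite eqn_leq.
by apply/andP; split; rewrite leqNgt; apply/negP => ltij; apply: norep;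
  [exists j, i | exists i, j].
Qed.

Section Orbits.
Variables (M : zmodType) (f : {additive M -> M}).

Lemma iter_raddfMn n x k : iter n f (x *+ k) = iter n f x *+ k.
Proof. by elim: n => //= n ->; rewrite raddfMn. Qed.

Lemma iter_raddfB n x y : iter n f (x - y) = iter n f x - iter n f y.
Proof. by elim: n => //= n ->; rewrite raddfB. Qed.

Lemma iter_raddf0 n : iter n f 0 = 0.
Proof. by elim: n => //= n ->; rewrite raddf0. Qed.

Variable x : nat -> M.
Hypothesis fx : forall n, f (x n.+1) = x n.

Lemma iter_backward k n : iter k f (x (k + n)%N) = x n.
Proof. by elim: k n => // k IHk n; rewrite iterS addSnnS IHk fx. Qed.

Lemma iter_backward_leq k n : (k <= n)%N -> iter k f (x n) = x (n - k)%N.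
Proof. by move=> kn; rewrite -{1}(subnKC kn) iter_backward. Qed.

Lemma iter_past_origin k n :
  (k < n)%N -> iter n f (x k) = iter (n - k.+1) f (f (x 0%N)).
Proof.
move=> ltkn; rewrite -[in LHS](subnK ltkn) addnS -addSn iterD.
by rewrite iter_backward_leq // subnn iterSr.
Qed.

Lemma null_stringI : x 0%N <> 0 -> f (x 0%N) = 0 -> null_string f x.
Proof.
move=> x0 fx0; split=> //; last by exists 1%N.
split=> // a b; wlog ltab : a b / (a < b)%N => [hwlog xab|xab].
  by case: (ltngtP a b) => // lt_ab; [exact: hwlog|exact/esym/hwlog].
(* x_a lies in the kernel of f ^ b while f ^ b maps x_b to x_0 *)
case: x0; rewrite -(iter_backward b 0) addn0 -xab.
by rewrite iter_past_origin // fx0 iter_raddf0.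
Qed.

Lemma nonsingular_stringI : ~ singular f x -> nonsingular_string f x.
Proof.
move=> nsing; split=> //; split=> // a b.
wlog ltab : a b / (a < b)%N => [hwlog xab|xab].
  by case: (ltngtP a b) => // lt_ab; [exact: hwlog|exact/esym/hwlog].
case: nsing; exists (b - a)%N, 0%N; split; first by lia.
rewrite /= -[RHS](iter_backward b 0) addn0 -xab.
by rewrite -[in RHS](subnK (ltnW ltab)) iterD iter_backward_leq // subnn.
Qed.

End Orbits.

(** * Primary components *)

Definition killed (G : zmodType) (n : nat) : set G := [set x | x *+ n = 0].
Arguments killed G n : clear implicits.

Lemma killedM_finite (G : zmodType) a b :
  finite_set (killed G a) -> finite_set (killed G b) ->
  finite_set (killed G (a * b)).
Proof.
move=> fina finb.
apply: (@sub_finite_set _ _ (\bigcup_(y in killed G b) [set x | x *+ a = y])).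
  by move=> x xab; exists (x *+ a); rewrite /killed //= -mulrnA.
apply: bigcup_finite => // y _.
have [[x0 x0y]|none] := pselect (exists x0, x0 *+ a = y); last first.
  by rewrite (_ : [set _ | _] = set0) // -subset0 => x xa; apply: none;
    exists x.
apply: (@sub_finite_set _ _ ((fun k => x0 + k) @` killed G a)).
  move=> x /= xa; exists (x - x0); last by rewrite addrC subrK.
  by rewrite /killed /= mulrnBl xa x0y subrr.
exact: finite_image.
Qed.

Lemma killed1_finite (G : zmodType) : finite_set (killed G 1).
Proof. by apply: (@sub_finite_set _ _ [set 0]) => // x;
  rewrite /killed /= mulr1n. Qed.

Lemma killedX_finite (G : zmodType) p k :
  finite_set (killed G p) -> finite_set (killed G (p ^ k)).
Proof.
move=> finp; elim: k => [|k IHk]; first exact: killed1_finite.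
by rewrite expnS; exact: killedM_finite.
Qed.

Lemma killed_finite (G : zmodType) :
  (forall p, prime p -> finite_set (killed G p)) ->
  forall n, (0 < n)%N -> finite_set (killed G n).
Proof.
move=> finp n; have [m] := ubnP n; elim: m n => // m IHm n nm n0.
have [->|n1] := eqVneq n 1%N; first exact: killed1_finite.
have pn : prime (pdiv n) by apply: pdiv_prime; lia.
rewrite -(divnK (pdiv_dvd n)); apply: killedM_finite; last exact: finp.
apply: IHm; last by rewrite divn_gt0 ?pdiv_gt0 // pdiv_leq.
by apply: (@leq_trans n); rewrite // ltn_Pdiv // prime_gt1.
Qed.

Lemma killed_sub_p_component (G : zmodType) p : killed G p `<=` p_component G p.
Proof. by move=> x xp; exists 1%N; rewrite expn1. Qed.

Lemma p_component_finite_inj (M G : zmodType) (i : {additive M -> G}) p :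
  injective i -> finite_set (p_component G p) -> finite_set (p_component M p).
Proof.
move=> i_inj finG; apply: (@sub_finite_set _ _ (i @^-1` p_component G p)).
  by move=> x [k xk]; exists k; rewrite -raddfMn xk raddf0.
by apply: finite_preimage => // x y _ _; exact: i_inj.
Qed.

Lemma killed_finite_inj (M G : zmodType) (i : {additive M -> G}) n :
  injective i -> finite_set (killed G n) -> finite_set (killed M n).
Proof.
move=> i_inj finG; apply: (@sub_finite_set _ _ (i @^-1` killed G n)).
  by move=> x xn; rewrite /killed /= -raddfMn xn raddf0.
by apply: finite_preimage => // x y _ _; exact: i_inj.
Qed.

Lemma coprime_mulrn_eq0 (G : zmodType) (z : G) a b :
  coprime a b -> z *+ a = 0 -> z *+ b = 0 -> z = 0.
Proof.
case: a => [|a]; first by rewrite /coprime gcd0n => /eqP -> _; rewrite mulr1n.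
move=> /eqP cop za zb; case: (egcdnP b (ltn0Sn a)) => u v uv _.
have : z *+ (u * a.+1) = 0 by rewrite mulnC mulrnA za mul0rn.
by rewrite uv cop mulrnDr mulnC mulrnA zb mul0rn add0r mulr1n.
Qed.

Lemma torsion_prime_multiple (G : zmodType) (z : G) :
  z \in torsion G -> z <> 0 ->
  exists p k : nat, [/\ prime p, z *+ k <> 0 & z *+ k *+ p = 0].
Proof.
move=> /torsionP[n n0 zn] z0.
have [m] := ubnP n; elim: m n n0 zn => // m IHm n n0 zn nm.
have n1 : n != 1%N by apply/eqP => n1; rewrite n1 mulr1n in zn.
have pn : prime (pdiv n) by apply: pdiv_prime; lia.
have [zk|zk] := eqVneq (z *+ (n %/ pdiv n)) 0.
  apply: (IHm (n %/ pdiv n)%N) => //.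
    by rewrite divn_gt0 ?pdiv_gt0 // pdiv_leq.
  by apply: (@leq_trans n); rewrite // ltn_Pdiv // prime_gt1.
exists (pdiv n), (n %/ pdiv n)%N; split=> //; first exact/eqP.
by rewrite -mulrnA divnK // pdiv_dvd.
Qed.

(** If such a sequence were nonzero, a multiple of its first nonzero term would
    have prime order [p]; then the [p]-parts of the same multiple of the later
    terms form a sequence in which each power of the endomorphism kills one
    more term, so that the [p]-component would be infinite. *)
Lemma torsion_backward_eq0 (M : zmodType) (f : {additive M -> M})
    (x : nat -> M) :
  (forall p, prime p -> finite_set (p_component M p)) ->
  (forall n, x n \in torsion M) -> (forall n, f (x n.+1) = x n) ->
  x 0%N = 0 -> forall n, x n = 0.
Proof.
move=> fint xt fx x0 n.
elim: n x xt fx x0 => // n IHn x xt fx x0.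
apply: (IHn (fun m => x m.+1)) => // {IHn n}.
apply: contrapT => x1;
  have [p [k [pp xk xkp]]] := torsion_prime_multiple (xt 1%N) x1.
have ppart n : exists e, [/\ p_component M p e, iter n f e <> 0 & iter n.+1 f e
  = 0].
  have /torsionP[m m0 xm] := xt n.+1.
  have [v copv mE] := pfactor_coprime pp m0.
  have fe : iter n f (x n.+1 *+ k *+ v) = x 1%N *+ k *+ v.
    by rewrite -addn1 !iter_raddfMn iter_backward.
  exists (x n.+1 *+ k *+ v); split.
  - by exists (logn p m); rewrite -!mulrnA -?mulnA -mE mulnC mulrnA xm mul0rn.
  - by rewrite fe => xkv; apply: xk; exact: (coprime_mulrn_eq0 copv).
  - by rewrite iterS fe !raddfMn fx x0 !mul0rn.
have [e eP] := choice ppart.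
have [|i [j [ltij eij]]] := finite_repetition (u := e) (fint p pp).
  by move=> n; have [] := eP n.
have [_ ejn0 _] := eP j; have [_ _ ei0] := eP i.
apply: ejn0; rewrite -eij -(subnK ltij) iterD ei0; exact: iter_raddf0.
Qed.

Lemma indexed_dependent_choice (T : Type) (D : T -> Prop)
    (R : nat -> T -> T -> Prop) (t0 : T) :
  D t0 -> (forall n t, D t -> exists2 t', D t' & R n t t') ->
  exists u : nat -> T, [/\ u 0%N = t0, forall n, D (u n)
    & forall n, R n (u n) (u n.+1)].
Proof.
move=> Dt0 step.
have next (nt : nat * T) : exists t', D nt.2 -> D t' /\ R nt.1 nt.2 t'.
  have [Dt|nDt] := pselect (D nt.2); last by exists nt.2.
  by have [t' Dt' Rt'] := step nt.1 _ Dt; exists t'.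
have [h hP] := choice next.
pose fix u n := if n is m.+1 then h (m, u m) else t0.
have Du n : D (u n) by elim: n => //= n Dn; exact: (hP (n, u n) Dn).1.
exists u; split=> // n; exact: (hP (n, u n) (Du n)).2.
Qed.

(** The subgroups [p ^ N G[p ^ oo]] of a group with finite [p]-socle are
    divisible by [p] for large [N]: their socles decrease inside a finite set,
    so they become stationary, and divisibility of the socle propagates to
    elements of order [p ^ k] by induction on [k]. Prime-to-[p] torsion is
    [p]-divisible anyway. *)
Lemma finite_socle_divisible (G : zmodType) (p : nat) :
  prime p -> finite_set (killed G p) ->
  exists N : nat, forall w, w \in torsion G ->
    exists2 u, u \in torsion G & w *+ p ^ N = u *+ p ^ N.+1.
Proof.
move=> pp finp.
have [N socleN] : exists N, forall x w : G,
    x *+ p = 0 -> x = w *+ p ^ N -> infinite_height p x.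
  have hx (x : G) : exists n, (exists w, x = w *+ p ^ n) -> infinite_height p x.
    have [hx|/asboolPn nhx] := pselect (infinite_height p x);
      first by exists 0%N.
    have [n nn] : exists n, ~ exists w, x = w *+ p ^ n.
      by apply/existsNP => all; apply: (asboolPn _ nhx).
    by exists n.
  have [n nP] := choice hx.
  move/finite_seqP: finp => [s sE]; exists (\max_(x <- s) n x) => x w xp xw.
  have xs : x \in s by have : killed G p x by []; rewrite sE.
  have le_n : (n x <= \max_(x <- s) n x)%N.
    by rewrite (big_rem x xs) /= leq_maxl.
  apply: nP; exists (w *+ p ^ (\max_(x <- s) n x - n x)).
  by rewrite -mulrnA -expnD subnK.
have primary k (w : G) : w *+ p ^ N *+ p ^ k = 0 -> exists u, w *+ p ^ N = u *+
  p ^ N.+1.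
  elim: k w => [|k IHk] w wk; first by exists 0; rewrite mul0rn.
  have [v vE] : exists v, w *+ p ^ N *+ p ^ k = v *+ p ^ (N.+1 + k).
    apply: (socleN _ (w *+ p ^ k)); first by rewrite -mulrnA -expnSr.
    by rewrite -!mulrnA mulnC.
  have [|u uE] := IHk (w - v *+ p).
    by rewrite !mulrnBl vE expnD expnS !mulrnA subrr.
  by exists (u + v); rewrite mulrnDl -uE mulrnBl -mulrnA -expnS subrK.
exists N => w wt; suff [u uE] : exists u, w *+ p ^ N = u *+ p ^ N.+1.
  exists u => //; rewrite -(@torsionMn _ u (p ^ N.+1)) ?expn_gt0 ?prime_gt0 //.
  by rewrite -uE rpredMn.
have /torsionP[n n0 wn] := wt.
have [m copm nE] := pfactor_coprime pp n0.
have [|u uE] := primary (logn p n) (w *+ m).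
  by rewrite -!mulrnA mulnCA -nE mulnC mulrnA wn mul0rn.
have m0 : (0 < m)%N by case: m copm nE {uE} => // _; lia.
have [a b abE _] := egcdnP p m0; rewrite gcdnC (eqP copm) in abE.
exists (u *+ a - w *+ b).
rewrite mulrnBl mulrnAC -uE expnS -mulrnA; apply/eqP; rewrite eq_sym subr_eq.
rewrite -!mulrnA -mulrnDr; apply/eqP; congr (w *+ _).
by move: (p ^ N)%N (congr1 (muln (p ^ N)) abE) => q; lia.
Qed.

(** * Free sequences *)

Section Combination.
Variables (R : nzRingType) (G : zmodType).

Section Sequence.
Variable e : nat -> {additive R -> G}.

Definition combination (P : {poly R}) : G := \sum_(i < size P) e i P`_i.

Lemma combinationE (P : {poly R}) n :
  (size P <= n)%N -> combination P = \sum_(i < n) e i P`_i.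
Proof.
move=> sPn; rewrite /combination (big_ord_widen _ (fun i => e i P`_i) sPn)
  big_mkcond /=.
apply: eq_bigr => i _; case: ltnP => // sPi.
by rewrite nth_default // raddf0.
Qed.

Lemma combination_zmod_morphism : zmod_morphism combination.
Proof.
move=> P Q; pose n := maxn (size P) (size Q).
have sPQ : (size (P - Q)%R <= n)%N.
  by rewrite (leq_trans (size_polyD _ _)) // size_polyN.
rewrite (combinationE sPQ) (combinationE (leq_maxl _ _ : (size P <= n)%N)).
rewrite (combinationE (leq_maxr _ _ : (size Q <= n)%N)) -sumrB.
by apply: eq_bigr => i _; rewrite coefB raddfB.
Qed.

HB.instance Definition _ := GRing.isZmodMorphism.Build _ _ combination
  combination_zmod_morphism.

Lemma combination_monomial n c : combination (c *: 'X^n) = e n c.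
Proof.
have sX : (size (c *: 'X^n : {poly R})%R <= n.+1)%N.
  by rewrite (leq_trans (size_scale_leq _ _)) // size_polyXn.
rewrite (combinationE sX) big_ord_recr big1 /= => [|i _].
  by rewrite add0r coefZ coefXn eqxx mulr1.
by rewrite coefZ coefXn (ltn_eqF (ltn_ord i)) mulr0 raddf0.
Qed.

Hypothesis e_free : injective combination.

Lemma free_seq_inj : injective (fun i => e i 1).
Proof.
move=> i j; rewrite -!combination_monomial !scale1r => /e_free/(congr1 (coefp
  i)) /=.
by rewrite !coefXn eqxx; case: eqP => // _ /eqP; rewrite oner_eq0.
Qed.

Lemma free_seq_infinite : infinite_set (range (fun i => e i 1)).
Proof.
move=> finr; have [|i [j [ltij /free_seq_inj eij]]] :=
  finite_repetition (u := fun i => e i 1) finr; first by move=> n; exists n.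
by rewrite eij ltnn in ltij.
Qed.

Lemma free_seq_independent (act : G -> R -> G) :
  (forall i c, e i c = act (e i 1) c) ->
  forall (s : seq G) (c : G -> R), uniq s ->
    [set` s] `<=` range (fun i => e i 1) ->
    \sum_(x <- s) act x (c x) = 0 -> forall x, x \in s -> c x = 0.
Proof.
move=> eact s c us sv sum0 x xs.
have hidx (y : G) : exists i, y \in s -> e i 1 = y.
  by have [/sv[i _ <-]|ns] := boolP (y \in s); [exists i|exists 0%N].
have [idx idxP] := choice hidx.
have P0 : \sum_(y <- s) c y *: 'X^(idx y) = 0 :> {poly R}.
  apply: e_free; rewrite raddf0 -[RHS]sum0 raddf_sum big_seq [RHS]big_seq.
  by apply: eq_bigr => y ys; rewrite /= combination_monomial eact idxP.
have := congr1 (coefp (idx x)) P0; rewrite /= coef0 coef_sum (bigD1_seq x) //=.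
rewrite coefZ coefXn eqxx mulr1 big_seq_cond big1 ?addr0 // => y /andP[ys yx].
rewrite coefZ coefXn; case: eqP => [exy|_]; last by rewrite mulr0.
by case/eqP: yx; rewrite -(idxP y ys) -exy idxP.
Qed.

End Sequence.

(** Greedy construction: a free sequence is a sequence each of whose terms
    satisfies no relation over the earlier ones.  Its terms are recorded as
    additive maps from the ring of scalars, so that integer combinations in
    [G] and combinations with coefficients in [F_p] in the socle [G[p]] become
    instances of the same notion. *)
Lemma greedy_free_seq :
  (forall (n : nat) (u : nat -> {additive R -> G}), exists h : {additive R ->
    G},
     forall (r : nat -> R) (c : R),
       h c + \sum_(i < n) u i (r i) = 0 -> c = 0) ->
  exists e : nat -> {additive R -> G}, injective (combination e).
Proof.
move=> extend; have [next nextP] := choice (fun nu => extend nu.1 nu.2).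
pose fix prefix n : nat -> {additive R -> G} :=
  if n is m.+1 then fun i => if (i < m)%N then prefix m i else next (m, prefix
    m)
  else fun=> \0.
pose e n := next (n, prefix n).
have prefixE n i : (i < n)%N -> prefix n i = e i.
  elim: n => //= n IHn; rewrite ltnS; case: ltngtP => // [/IHn -> //|->] //.
exists e; apply: raddf_inj => P; rewrite /= /combination.
case sP : (size P) => [|n]; first by move=> _; apply/eqP;
  rewrite -size_poly_eq0 sP.
rewrite big_ord_recr /= addrC => sum0.
have : P`_n = 0.
  apply: (nextP (n, prefix n) (fun i => P`_i)); rewrite -[RHS]sum0.
  by congr (_ + _); apply: eq_bigr => i _; rewrite /= prefixE.
by move=> lc0; apply/eqP; rewrite -lead_coef_eq0 lead_coefE sP /= lc0.
Qed.

End Combination.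

(** * Infinite ranks *)

Lemma free_seq_rank0 (G : zmodType) (e : nat -> {additive int -> G}) :
  injective (combination e) -> rank0 G = +oo%E.
Proof.
move=> e_free; apply: ereal_supy; exists (range (fun i => e i 1)).
  move=> s c us sv; apply: (free_seq_independent e_free) us sv => i z.
  by rewrite -[in LHS](intz z) raddfMz.
exact/xcard_infinite/free_seq_infinite.
Qed.

(** Write [A = L D S] in Smith normal form: the last row of [D] is zero because
    [D] has more rows than columns, so the last row of the inverse of [L]
    annihilates [A]. *)
Lemma int_row_kernel (m n : nat) (A : 'M[int]_(m, n)) :
  (n < m)%N -> exists2 v : 'rV[int]_m, v != 0 & v *m A = 0.
Proof.
case: m A => // m A; rewrite ltnS => le_nm.
have [L Lu [S _ [d _ AE]]] := int_Smith_normal_form A.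
exists (row ord_max (invmx L)).
  apply/eqP => v0; have : row ord_max (invmx L *m L) = 0 by rewrite row_mul v0
    mul0mx.
  rewrite mulVmx // => /rowP/(_ ord_max); rewrite !mxE eqxx => /eqP.
  by rewrite oner_eq0.
rewrite AE -row_mul !mulmxA mulVmx // mul1mx row_mul.
rewrite (_ : row _ _ = 0) ?mul0mx //; apply/rowP => j.
by rewrite !mxE /= gtn_eqF // (leq_trans (ltn_ord j)).
Qed.

(** Steinitz exchange: the relations of [n.+1] elements over [n] given ones form
    a matrix with more rows than columns, and a row vector in its kernel is a
    relation between these elements alone. *)
Lemma xcard_independent_le (G : zmodType) (n : nat)
    (u : nat -> {additive int -> G}) :
  (forall y : G, exists2 c : int, c != 0 &
     exists r : nat -> int, y *~ c + \sum_(i < n) u i (r i) = 0) ->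
  forall X : set G, Z_independent X -> (xcard X <= n%:R%:E)%E.
Proof.
move=> dep X Xind; rewrite leNgt; apply/negP => /lt_xcardP[t [ut st tX]].
have [c cP] : exists c : G -> int, forall y, c y != 0 /\
    exists r : nat -> int, y *~ c y + \sum_(i < n) u i (r i) = 0.
  have dep' (y : G) : exists c : int, c != 0 /\ exists r : nat -> int,
      y *~ c + \sum_(i < n) u i (r i) = 0.
    by have [c c0 rP] := dep y; exists c.
  by have [c cP] := choice dep'; exists c.
have [r rP] := choice (fun y => (cP y).2).
pose A : 'M[int]_(size t, n) := \matrix_(j, i) r (nth 0 t j) i.
have [|v v0 vA] := int_row_kernel A; first by rewrite st.
pose l x := if insub (index x t) is Some j then v 0 j else 0.
have lE (j : 'I_(size t)) : l (nth 0 t j) = v 0 j.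
  by rewrite /l index_uniq // insubT // => lt_j; congr (v 0 _); exact/val_inj.
have sum0 : \sum_(x <- t) x *~ (c x * l x) = 0.
  rewrite (big_nth 0) big_mkord.
  have -> : \sum_(j < size t) nth 0 t j *~ (c (nth 0 t j) * l (nth 0 t j)) =
      - \sum_(i < n) u i ((v *m A) 0 i).
    rewrite -sumrN; under [RHS]eq_bigr => i _ do rewrite mxE raddf_sum -sumrN.
    rewrite exchange_big; apply: eq_bigr => j _.
    have /eqP := rP (nth 0 t j); rewrite addr_eq0 => /eqP yE.
    rewrite mulrzA yE mulNrz mulrz_suml -sumrN; apply: eq_bigr => i _.
    by rewrite mxE lE mulrC -raddfMz mulrzz.
  by rewrite vA big1 ?oppr0 // => i _; rewrite mxE raddf0.
case/eqP: v0; apply/rowP => j; rewrite mxE -lE.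
have := Xind t (fun x => c x * l x) ut tX sum0 (nth 0 t j) (mem_nth _ (ltn_ord
  j)).
by move/eqP; rewrite mulf_eq0 (negPf (cP _).1) => /eqP.
Qed.

(** A finite sequence on which everything depends would bound the torsion-free
    rank by its length. *)
Lemma rank0_infinite_free_seq (G : zmodType) :
  ~ (rank0 G < +oo)%E ->
  exists e : nat -> {additive int -> G}, injective (combination e).
Proof.
move=> rkoo; apply: greedy_free_seq => n u; apply: contrapT => nofree;
  apply: rkoo.
apply: (@le_lt_trans _ _ n%:R%:E); last exact: ltry.
apply: ge_ereal_sup => _ [X Xind <-];
  apply: (@xcard_independent_le _ n u) => // y.
apply: contrapT => nodep; apply: nofree; exists (intmul y) => r c rel.
by apply/eqP; apply: contrapT => /negP c0; apply: nodep; exists c => //;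
  exists r.
Qed.

Lemma Fp_additive (G : zmodType) (p : nat) (x : G) : prime p -> x *+ p = 0 ->
  exists h : {additive 'F_p -> G}, h 1 = x.
Proof.
move=> pp xp; pose h (c : 'F_p) := x *+ c.
have xmod q n : q = p -> x *+ (n %% q) = x *+ n.
  by move=> ->; rewrite [in RHS](divn_eq n p) mulrnDr mulnC mulrnA xp mul0rn
    add0r.
have hD : nmod_morphism h.
  split=> [|c d]; first by rewrite /h mulr0n.
  by rewrite /h -mulrnDr /= xmod // Fp_cast.
pose H := GRing.isNmodMorphism.Build _ _ h hD.
pose h' : {additive 'F_p -> G} := HB.pack h H.
by exists h'; rewrite /= /h /= xmod ?mulr1n // Fp_cast.
Qed.

Lemma Fp_additiveM (G : zmodType) (p : nat) (h : {additive 'F_p -> G}) (c d :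
  'F_p) :
  prime p -> h (c * d) = h c *+ d.
Proof.
by move=> pp; rewrite -raddfMn -[in LHS](natr_Zp d) mulr_natr.
Qed.

(** A finite family spans a finite subspace of [G[p]]. *)
Lemma infinite_killed_free_seq (G : zmodType) (p : nat) : prime p ->
  infinite_set (killed G p) ->
  exists e : nat -> {additive 'F_p -> G}, injective (combination e).
Proof.
move=> pp infG; apply: greedy_free_seq => n u.
pose span (r : {ffun 'I_n -> 'F_p}) := \sum_(i < n) u i (r i).
have [x [xp xspan]] : exists x, killed G p x /\ ~ range span x.
  apply: contrapT => none; apply: infG;
    apply: (@sub_finite_set _ _ (range span)).
    by move=> x xp; apply: contrapT => nx; apply: none; exists x.
  exact/finite_image/finite_finset.
have [h h1] := Fp_additive pp xp; exists h => r c rel.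
apply/eqP; apply: contrapT => /negP c0; apply: xspan.
exists [ffun i : 'I_n => - (r i / c)] => //.
have /eqP := rel; rewrite addr_eq0 => /eqP hc.
rewrite -h1 -(mulfV c0) Fp_additiveM // hc mulNrn -sumrMnl -sumrN.
by apply: eq_bigr => i _; rewrite ffunE raddfN Fp_additiveM.
Qed.

Lemma rankp_finiteP (G : zmodType) (p : nat) : prime p ->
  (rankp G p < +oo)%E <-> finite_set (killed G p).
Proof.
move=> pp; split=> [rkp|finG].
  apply: contrapT => /(infinite_killed_free_seq pp)[e e_free].
  move: rkp; rewrite /rankp (_ : ereal_sup _ = +oo%E) ?ltxx //.
  apply: ereal_supy; exists (range (fun i => e i 1)).
    split=> [_ [i _ <-]|s c us sv].
      by rewrite /= -raddfMn pchar_Fp_0 // raddf0.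
    apply: (free_seq_independent (act := fun x (z : 'F_p) => x *+ z) e_free _
      us sv).
    by move=> i z; rewrite -Fp_additiveM ?mul1r.
  exact/xcard_infinite/free_seq_infinite.
apply: le_lt_trans (xcard_finite finG).
apply: ge_ereal_sup => _ [X [XG _] <-].
rewrite leNgt; apply/negP.
have -> : xcard (killed G p) = #|` fset_set (killed G p)|%:R%:E.
  by rewrite /xcard /counting asboolT.
move=> /lt_xcardP[s [us ss sX]].
have : (#|` fset_set (killed G p)|%:R%:E < xcard (killed G p))%E.
  by apply/lt_xcardP; exists s; split=> // x /sX/XG.
by rewrite /xcard /counting asboolT // ltxx.
Qed.

(** * Groups containing strings *)

Lemma embedded_sub (P Q : forall M : zmodType, (M -> M) -> set (nat -> M)) G :
  (forall M f, P M f `<=` Q M f) -> embedded P G -> embedded Q G.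
Proof. by move=> PQ [M [i [f [x [i_inj Px]]]]]; exists M, i, f, x; split=> //;
  exact: PQ. Qed.

Section FreeSequences.
Variables (R : nzRingType) (G : zmodType) (e : nat -> {additive R -> G}).
Hypothesis e_free : injective (combination e).

Lemma drop_polyXS n : drop_poly 1 ('X^(n.+1) : {poly R}) = 'X^n.
Proof. by rewrite exprSr -{1}(expr1 'X) drop_polyMXn_id. Qed.

Lemma drop_poly1_1 : drop_poly 1 (1 : {poly R}) = 0.
Proof. by rewrite drop_poly_eq0 // size_poly1. Qed.

Lemma free_seq_null : embedded null_string G.
Proof.
exists {poly R}, (combination e), (drop_poly 1), (fun n => 'X^n); split=> //.
apply: null_stringI => [n||]; first exact: drop_polyXS.
  by apply/eqP; rewrite expr0 oner_eq0.
by rewrite expr0; exact: drop_poly1_1.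
Qed.

(** The bilateral shift: the first polynomial carries the basis vectors of
    nonnegative index and the second one those of negative index. *)
Definition bilateral_shift (PQ : {poly R} * {poly R}) : {poly R} * {poly R} :=
  (drop_poly 1 PQ.1, 'X * PQ.2 + (PQ.1`_0)%:P).

Lemma bilateral_shift_zmod_morphism : zmod_morphism bilateral_shift.
Proof.
move=> [P Q] [P' Q']; congr pair; first by rewrite /= raddfB.
by rewrite /= coefB polyCB mulrBr opprD addrACA.
Qed.

HB.instance Definition _ := GRing.isZmodMorphism.Build _ _ bilateral_shift
  bilateral_shift_zmod_morphism.

Definition interleave (PQ : {poly R} * {poly R}) : {poly R} :=
  PQ.1 \Po 'X^2 + (PQ.2 \Po 'X^2) * 'X.

Lemma interleave_zmod_morphism : zmod_morphism interleave.
Proof.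
move=> [P Q] [P' Q']; rewrite /interleave /= !comp_polyB mulrBl opprD.
by rewrite addrACA.
Qed.

HB.instance Definition _ := GRing.isZmodMorphism.Build _ _ interleave
  interleave_zmod_morphism.

Lemma interleave_inj : injective interleave.
Proof.
apply: raddf_inj => -[P Q] /= /polyP PQ0; congr pair; apply/polyP => i.
  have := PQ0 (i * 2)%N; rewrite coefD coefMX !coef_comp_poly_Xn // !coef0.
  rewrite dvdn_mull // mulnK //=; case: ifP => [_|i0]; first by rewrite addr0.
  by rewrite -subn1 (_ : (2 %| i * 2 - 1)%N = false) ?addr0 //; lia.
have := PQ0 (i * 2).+1; rewrite coefD coefMX /= !coef_comp_poly_Xn // !coef0.
rewrite dvdn_mull // mulnK // (_ : (2 %| (i * 2).+1)%N = false) ?add0r //; lia.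
Qed.

Lemma free_seq_nonsingular : embedded nonsingular_string G.
Proof.
exists ({poly R} * {poly R})%type, (combination e \o interleave),
  bilateral_shift.
exists (fun n => ('X^n, 0)); split; first exact: inj_comp e_free interleave_inj.
apply: nonsingular_stringI => [n|].
  rewrite /= /bilateral_shift /= drop_polyXS mulr0 add0r.
  by rewrite coefXn polyC0.
have forward k : iter k.+1 bilateral_shift ('X^0, 0) = (0, 'X^k).
  elim: k => [|k IHk].
    by rewrite /= /bilateral_shift /= !expr0 drop_poly1_1 mulr0 add0r coef1.
  rewrite iterS IHk /bilateral_shift /= drop_poly_eq0 ?size_poly0 // coef0.
  by rewrite addr0 -exprS.
have X0 k : 'X^k <> 0 :> {poly R}.
  by move/eqP; rewrite -size_poly_eq0 size_polyXn.
move=> [[|j] [[|k] [jk]]]; rewrite ?forward //=.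
- by move=> [_ /esym/X0].
- by move=> [_ /X0].
- move=> [/(congr1 (fun P : {poly R} => size P))]; rewrite !size_polyXn => jk'.
  by case: jk; congr _.+1; lia.
Qed.

End FreeSequences.

Definition scalen (G : zmodType) (n : nat) (x : G) : G := x *+ n.

Lemma scalen_zmod_morphism (G : zmodType) n : zmod_morphism (@scalen G n).
Proof. by move=> x y; exact: mulrnBl. Qed.

HB.instance Definition _ (G : zmodType) n :=
  GRing.isZmodMorphism.Build G G (@scalen G n) (@scalen_zmod_morphism G n).

Lemma iter_scalen (G : zmodType) n k (x : G) : iter k (@scalen G n) x = x *+ n
  ^ k.
Proof. by elim: k => [|k IHk] /=;
  rewrite ?mulr1n // IHk /scalen -mulrnA expnSr. Qed.

Lemma infinite_killed_null (G : zmodType) (p : nat) : prime p ->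
  infinite_set (killed G p) -> embedded null_string G.
Proof. by move=> pp /(infinite_killed_free_seq pp)[e];
  exact: free_seq_null. Qed.

Lemma infinite_killed_nonsingular (G : zmodType) (p : nat) : prime p ->
  infinite_set (killed G p) -> embedded nonsingular_string G.
Proof. by move=> pp /(infinite_killed_free_seq pp)[e];
  exact: free_seq_nonsingular. Qed.

(** Either the [p]-socle is infinite and contains the unilateral shift, or the
    infinite [p]-component contains a nonzero [p]-divisible subgroup, whose
    elements of order [p] start a null string of the multiplication by [p]. *)
Lemma infinite_p_component_null (G : zmodType) (p : nat) : prime p ->
  infinite_set (p_component G p) -> embedded null_string G.
Proof.
move=> pp inft; have [finp|] := pselect (finite_set (killed G p));
  last exact: infinite_killed_null.
have [N divN] := finite_socle_divisible pp finp.
have [w [[k wk] wN]] : exists w, p_component G p w /\ w *+ p ^ N <> 0.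
  apply: contrapT => none; apply: inft.
  apply: (@sub_finite_set _ _ (killed G (p ^ N))); last exact: killedX_finite.
  by move=> w wp; apply: contrapT => wN; apply: none; exists w.
(* the last nonzero multiple w p^(N+m) of w p^N is the start of the string *)
have exk : exists k, w *+ p ^ N *+ p ^ k == 0.
  by exists k; rewrite mulrnAC wk mul0rn.
have [[|m] /eqP wm m_min] := ex_minnP exk; first by rewrite mulr1n in wm.
pose D x := exists2 v, v \in torsion G & x = v *+ p ^ N.
have [|n x [v vt ->]|c [c0 _ cS]] := @indexed_dependent_choice _ D
    (fun _ x y => y *+ p = x) (w *+ p ^ N *+ p ^ m).
- exists (w *+ p ^ m); last by rewrite mulrnAC.
  by apply: rpredMn; apply/torsionP; exists (p ^ k)%N;
    rewrite ?expn_gt0 ?prime_gt0.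
- have [u ut ->] := divN v vt; exists (u *+ p ^ N); first by exists u.
  by rewrite -mulrnA expnSr.
exists G, idfun, (@scalen G p), c; split=> //; apply: null_stringI => [n||].
- exact: cS.
- by rewrite c0 => cm; have := m_min m; rewrite cm eqxx ltnn => /(_ isT).
- by rewrite c0 /= /scalen -mulrnA -expnSr.
Qed.

(** Two elements independent modulo torsion generate a copy of [Z^2], on which
    the unipotent matrix acts with infinite orbits in both directions. *)
Lemma independent_pair_nonsingular (G : zmodType) :
  ~ pairwise_dependent (modt G) -> embedded nonsingular_string G.
Proof.
move=> nodep.
have [a [b abP]] : exists a b : G, forall c d : int,
    a *~ c + b *~ d \in torsion G -> c = 0 /\ d = 0.
  apply: contrapT => none; apply: nodep => u v.
  have [a <-] := to_modt_surj u; have [b <-] := to_modt_surj v.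
  apply: contrapT => nrel; apply: none; exists a, b => c d.
  rewrite -to_modt_eq0 raddfD /= !raddfMz => /eqP rel.
  apply: contrapT => cd; apply: nrel; exists (c, d) => //.
  by apply/eqP => -[c0 d0]; apply: cd.
pose i (cd : int * int) : G := a *~ cd.1 + b *~ cd.2.
have iB : zmod_morphism i.
  by move=> [c d] [c' d']; rewrite /i /= !mulrzBr opprD addrACA.
pose f (cd : int * int) : int * int := (cd.1 + cd.2, cd.2).
have fB : zmod_morphism f.
  by move=> [c d] [c' d']; congr pair; rewrite /= opprD addrACA.
pose iA : {additive int * int -> G} := HB.pack i (GRing.isZmodMorphism.Build _
  _ i iB).
pose fA : {additive int * int -> int * int} :=
  HB.pack f (GRing.isZmodMorphism.Build _ _ f fB).
exists (int * int)%type, iA, fA, (fun n => (- n%:Z, 1)); split.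
  apply: raddf_inj => -[c d] /= cd0; have [|-> ->] // := abP c d.
  by rewrite -[_ + _]/(i (c, d)) cd0 rpred0.
apply: nonsingular_stringI => [n|].
  by rewrite /= /f /=; congr pair; lia.
have forward k : iter k f (- 0%:Z, 1) = (k%:Z, 1).
  by elim: k => //= k ->; rewrite /f /=; congr pair; lia.
by move=> [j [k [jk]]]; rewrite /= !forward => -[].
Qed.

(** Liftings [y n] of [p ^- n x] only satisfy [p y (n+1) = y n] up to torsion.
    After multiplication by [p ^ N] the error lies in [p ^ N t(G)], which is
    [p]-divisible, so it can be corrected step by step. *)
Lemma infinite_height_nonsingular (G : zmodType) (p : nat) (x : modt G) :
  prime p -> finite_set (killed G p) -> infinite_height p x -> x <> 0 ->
  embedded nonsingular_string G.
Proof.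
move=> pp finp hx x0; have [N divN] := finite_socle_divisible pp finp.
have lift n : exists y, x = to_modt G y *+ p ^ n.
  by have [z ->] := hx n; have [y <-] := to_modt_surj z; exists y.
have [y yP] := choice lift.
have y_torsion n : y n - y n.+1 *+ p \in torsion G.
  rewrite -(@torsionMn _ _ (p ^ n)) ?expn_gt0 ?prime_gt0 //.
  rewrite -to_modt_eq0 raddfMn raddfB /= raddfMn mulrnBl -mulrnA -expnS -!yP.
  by rewrite subrr.
pose D z := exists2 v, v \in torsion G & z = v *+ p ^ N.
have [||c [c0 _ cS]] := @indexed_dependent_choice _ D
    (fun n z z' => z' *+ p = (y n - y n.+1 *+ p) *+ p ^ N + z) 0.
- by exists 0; rewrite ?rpred0 ?mul0rn.
- move=> n _ [v vt ->]; rewrite -mulrnDl.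
  have [|u ut ->] := divN (y n - y n.+1 *+ p + v); first by rewrite rpredD.
  by exists (u *+ p ^ N); [exists u|rewrite -mulrnA expnSr].
exists G, idfun, (@scalen G p), (fun n => y n *+ p ^ N + c n); split=> //.
apply: nonsingular_stringI => [n|].
  rewrite /= /scalen mulrnDl cS addrA mulrnBl mulrnAC addrCA.
  by rewrite [y n.+1 *+ _ *+ _]mulrnAC subrr addr0.
have y0 : y 0%N *+ p ^ N \notin torsion G.
  rewrite torsionMn ?expn_gt0 ?prime_gt0 // -to_modt_eq0; apply/eqP => y0.
  by apply: x0; rewrite (yP 0%N) y0 mul0rn.
move=> [j [k [jk]]]; rewrite c0 addr0 /= !iter_scalen => ejk.
wlog ltjk : j k jk ejk / (j < k)%N => [hwlog|].
  case: (ltngtP j k) => // lt_jk; first exact: (hwlog j k).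
  by apply: (hwlog k j) => // /esym.
case/negP: y0; apply/torsionP; exists (p ^ k - p ^ j)%N.
  by rewrite subn_gt0 ltn_exp2l // prime_gt1.
by rewrite mulrnBr ?ejk ?subrr // leq_exp2l ?prime_gt1 // ltnW.
Qed.

Lemma rank_le1_fails_nonsingular (G : zmodType) :
  (forall p, prime p -> finite_set (killed G p)) ->
  ~ rank_le1_no_infinity (modt G) -> embedded nonsingular_string G.
Proof.
move=> finp; rewrite (rank_le1_no_infinityP (@modt_torsion_free G)).
move=> /not_andP[|noinf]; first exact: independent_pair_nonsingular.
apply: contrapT => noemb; apply: noinf => p x pp hx; apply: contrapT => x0.
by apply: noemb; exact: (infinite_height_nonsingular pp (finp p pp) hx).
Qed.

(** * Endomorphisms of torsion-free groups of rank at most one *)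

Lemma mulrz_expn (A : zmodType) (x : A) (p k : nat) :
  x *~ (p%:Z ^+ k) = x *+ p ^ k.
Proof. by rewrite pmulrn -!natz natrX. Qed.

Lemma infinite_height_coprime (A : zmodType) (p : nat) (b : int) (x : A) :
  coprimez p%:Z b -> (forall k, exists z, x *~ (b ^+ k) = z *+ p ^ k) ->
  infinite_height p x.
Proof.
move=> copb hx k; have [z xz] := hx k.
have /coprimezP[[u v] /= uv] : coprimez (p%:Z ^+ k) (b ^+ k).
  by rewrite coprimezXl // coprimezXr.
have xuv : x = x *~ (u * p%:Z ^+ k) + x *~ (b ^+ k * v).
  by rewrite -mulrzDr [b ^+ k * v]mulrC uv mulr1z.
exists (x *~ u + z *~ v); rewrite {1}xuv mulrnDl mulrzA mulrz_expn.
by rewrite mulrzA xz !pmulrn [z *~ v *~ _]mulrzAC.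
Qed.

Lemma exists_prime_dvdz (a : int) : `|a|%N != 1%N ->
  exists2 p : nat, prime p & (p%:Z %| a)%Z.
Proof.
have [->|a0] := eqVneq a 0; first by exists 2%N => //; rewrite dvdz0.
move=> a1; exists (pdiv `|a|%N); last exact: pdiv_dvd.
by apply: pdiv_prime; move: a0 a1; rewrite -absz_gt0; lia.
Qed.

(** The fraction [a / b] is read off, in lowest terms, from a relation between
    [f y0] and [y0] for a single nonzero [y0]; every other element satisfies a
    relation with [y0], which carries the fraction over to it. *)
Lemma rank1_endo_fraction (A : zmodType) (f : {additive A -> A}) :
  torsion_free A -> pairwise_dependent A ->
  exists a b : int, coprimez a b /\ forall y, f y *~ b = y *~ a.
Proof.
move=> tfA depA.
have [allA0|/existsNP[y0 y00]] := pselect (forall y : A, y = 0).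
  exists 1, 1; split=> [//|y].
  by rewrite !mulr1z (allA0 y) raddf0.
have [[c d] /= cd0 rel] := depA (f y0) y0.
have c0 : c != 0.
  apply: contraTneq cd0 => c0; rewrite c0 mulr0z add0r in rel.
  rewrite negbK c0; have [->//|d0] := eqVneq d 0.
  by case: y00; exact: (torsion_freeMz tfA d0).
have [u [v uv]] := Bezoutz c d.
pose g := gcdz c d; have g0 : g != 0 by rewrite gcdz_eq0 (negPf c0).
have [b cE] : exists b, c = b * g by apply/dvdzP/dvdz_gcdl.
have [a dE] : exists a, d = - a * g.
  by have /dvdzP[a aE] := dvdz_gcdr c d; exists (- a); rewrite opprK.
exists a, b; split.
  apply/coprimezP; exists (- v, u) => /=; apply: (mulIf g0).
  by rewrite mul1r -[RHS]uv [in RHS]cE [in RHS]dE; lia.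
have ab0 : f y0 *~ b - y0 *~ a = 0.
  apply: (torsion_freeMz tfA g0); rewrite mulrzBl -!mulrzA -cE -[RHS]rel dE.
  by rewrite mulNr mulrNz.
move=> y; have [[k l] /= kl0 yrel] := depA y y0.
have k0 : k != 0.
  apply: contraTneq kl0 => k0; rewrite k0 mulr0z add0r in yrel.
  rewrite negbK k0; have [->//|l0] := eqVneq l 0.
  by case: y00; exact: (torsion_freeMz tfA l0).
apply/eqP; rewrite -subr_eq0; apply/eqP; apply: (torsion_freeMz tfA k0).
have /eqP := yrel; rewrite addr_eq0 -mulrNz => /eqP yk.
rewrite mulrzBl -!mulrzA ![_ * k]mulrC !mulrzA -raddfMz yk raddfMz.
by rewrite -!mulrzA ![- l * _]mulrC !mulrzA -mulrzBl ab0 mul0rz.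
Qed.

(** A prime factor of the numerator [a] makes all the [x n] infinitely
    divisible, because [x n] is the image of [x (n + k)] under [(a / b) ^ k];
    a prime factor of the denominator [b] makes the whole group so.  Without
    infinite heights, [f] is therefore [1] or [-1] as soon as [x] is nonzero. *)
Lemma rank1_backward_period (A : zmodType) (f : {additive A -> A})
    (x : nat -> A) :
  torsion_free A -> pairwise_dependent A -> no_infinite_height A ->
  (forall n, f (x n.+1) = x n) -> forall n, x n.+2 = x n.
Proof.
move=> tfA depA noinf fx n.
have [a [b [copab fab]]] := rank1_endo_fraction f tfA depA.
have step m : x m *~ b = x m.+1 *~ a by rewrite -fx fab.
have [a1|/exists_prime_dvdz[p pp /dvdzP[a' aE]]] := eqVneq `|a|%N 1%N;
  last first.
  suff x0 m : x m = 0 by rewrite !x0.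
  apply: (noinf p) => //; apply: (infinite_height_coprime (b := b)).
    by move: copab; rewrite aE coprimezMl => /andP[].
  move=> k; exists (x (m + k)%N *~ a' ^+ k).
  have -> : x m *~ b ^+ k = x (m + k)%N *~ a ^+ k.
    elim: k => [|k IHk]; first by rewrite addn0.
    by rewrite exprSr mulrzA IHk -mulrzA mulrC mulrzA step -mulrzA -exprS addnS.
  by rewrite aE exprMn mulrzA mulrz_expn.
have [b1|/exists_prime_dvdz[p pp /dvdzP[b' bE]]] := eqVneq `|b|%N 1%N;
  last first.
  suff all0 (y : A) : y = 0 by rewrite (all0 (x n.+2)) (all0 (x n)).
  apply: (noinf p) => //; apply: (infinite_height_coprime (b := a)).
    by move: copab; rewrite bE coprimezMr coprimez_sym => /andP[_];
      rewrite coprimez_sym.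
  move=> k; exists (iter k f y *~ b' ^+ k).
  have -> : y *~ a ^+ k = iter k f y *~ b ^+ k.
    elim: k => [|k IHk] //=.
    by rewrite exprSr mulrzA IHk exprS !mulrzA fab -!mulrzA mulrC.
  by rewrite bE exprMn mulrzA mulrz_expn.
have sqr1 (c : int) : `|c|%N = 1%N -> c * c = 1 by lia.
rewrite -[RHS]mulr1z -(sqr1 b b1) mulrzA step -mulrzA mulrC mulrzA step.
by rewrite -mulrzA (sqr1 a a1) mulr1z.
Qed.

(** * Groups without strings *)

Section NoStrings.
Variable G : zmodType.

Lemma string_period_torsion (M : zmodType) (i : {additive M -> G})
    (f : {additive M -> M}) (x : nat -> M) :
  injective i -> rank_le1_no_infinity (modt G) ->
  (forall n, f (x n.+1) = x n) -> forall n, x n - x n.+2 \in torsion M.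
Proof.
move=> i_inj /(rank_le1_no_infinityP (@modt_torsion_free G))[depG noinfG] fx n.
have j_inj := modt_map_inj i_inj.
rewrite -to_modt_eq0 raddfB subr_eq0 eq_sym; apply/eqP.
apply: (@rank1_backward_period _ (modt_map f) (fun n => to_modt M (x n))).
- exact: modt_torsion_free.
- exact: pairwise_dependent_inj j_inj depG.
- exact: no_infinite_height_inj j_inj noinfG.
- by move=> m; rewrite /= modt_mapE fx.
Qed.

(** The differences [x n - x (n+2)] are torsion elements, killed by an integer
    [m] independent of [n] because a backward orbit of torsion elements that
    starts at [0] vanishes.  So the terms of even index stay in
    a coset of the finite group [M[m]]. *)
Lemma not_embedded_string :
  (forall p, prime p -> finite_set (p_component G p)) ->
  rank_le1_no_infinity (modt G) -> ~ embedded is_string G.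
Proof.
move=> fint rkG [M [i [f [x [i_inj [x_inj fx]]]]]].
have fintM p (pp : prime p) := p_component_finite_inj i_inj (fint p pp).
have xt := string_period_torsion i_inj rkG fx.
have /torsionP[m m0 xm] := xt 0%N.
have period n : (x n - x n.+2) *+ m = 0.
  apply: (torsion_backward_eq0 (f := f) fintM (x := fun n => (x n - x n.+2) *+
    m)) => // {}n.
    exact: rpredMn.
  by rewrite raddfMn raddfB /= !fx.
have fin : finite_set (killed M m).
  apply: killed_finite m0 => p pp; apply: sub_finite_set (fintM p pp).
  exact: killed_sub_p_component.
have [|j [k [ltjk]]] := finite_repetition (u := fun n => x n.*2 - x 0%N) fin.
  elim=> [|n IHn]; first by rewrite /killed /= subrr mul0rn.
  rewrite /killed /= doubleS -(subrK (x n.*2) (x n.*2.+2)) -addrA mulrnDl IHn.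
  by rewrite addr0 -opprB mulNrn period oppr0.
by move=> /addIr/x_inj/double_inj ejk; rewrite ejk ltnn in ltjk.
Qed.

(** Now only the socles are finite, and backward orbits may escape; but the
    even forward orbit of [x 0] stays in a coset of the finite group [M[m]],
    where [m] kills [f (f (x 0)) - x 0]. *)
Lemma not_embedded_nonsingular :
  (forall p, prime p -> finite_set (killed G p)) ->
  rank_le1_no_infinity (modt G) -> ~ embedded nonsingular_string G.
Proof.
move=> finp rkG [M [i [f [x [i_inj [[x_inj fx] nsing]]]]]].
have finpM p (pp : prime p) := killed_finite_inj i_inj (finp p pp).
have : iter 2 f (x 0%N) - x 0%N \in torsion M.
  have -> : iter 2 f (x 0%N) - x 0%N = f (f (x 0%N - x 2%N)) by rewrite !raddfB
    /= !fx.
  by do 2!apply: raddf_torsion; exact: (string_period_torsion i_inj rkG fx).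
move=> /torsionP[m m0 fm]; have fin := killed_finite finpM m0.
have [|j [k [ltjk]]] := finite_repetition (u := fun n => iter n.*2 f (x 0%N) -
  x 0%N) fin.
  elim=> [|n IHn]; first by rewrite /killed /= subrr mul0rn.
  have -> : iter n.+1.*2 f (x 0%N) - x 0%N =
      iter n.*2 f (iter 2 f (x 0%N) - x 0%N) + (iter n.*2 f (x 0%N) - x 0%N).
    by rewrite iter_raddfB -iterD addn2 -doubleS addrA subrK.
  by rewrite /killed /= mulrnDl IHn addr0 -iter_raddfMn fm iter_raddf0.
move=> /addIr ejk; apply: nsing; exists j.*2, k.*2; split=> //.
by move=> /double_inj jk; rewrite jk ltnn in ltjk.
Qed.

Lemma iter_additive (M : zmodType) (f : {additive M -> M}) n :
  exists g : {additive M -> M}, forall y, g y = iter n f y.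
Proof.
elim: n => [|n [g gE]]; first by exists idfun.
by exists (f \o g) => y; rewrite /= gE.
Qed.

(** If [v 0] is not torsion while [f (v 0)] is, then [f ^ n] maps a nontrivial
    relation with leading term [v n] to a nonzero multiple of [v 0] modulo
    torsion; so the [v n] are independent. *)
Lemma triangular_rank0 (M : zmodType) (i : {additive M -> G})
    (f : {additive M -> M}) (v : nat -> M) :
  injective i -> (forall n, f (v n.+1) = v n) ->
  v 0%N \notin torsion M -> f (v 0%N) \in torsion M -> rank0 G = +oo%E.
Proof.
move=> i_inj fv v0 fv0; apply: (@free_seq_rank0 _ (fun n => intmul (i (v n)))).
apply: raddf_inj => P; rewrite /= /combination.
under eq_bigr => j _ do rewrite /= -raddfMz.
rewrite -raddf_sum -[RHS](raddf0 i) => /i_inj rel.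
apply/eqP; rewrite -size_poly_eq0; case sP : (size P) rel => [//|n].
have [g gE] := iter_additive f n.
move=> /(congr1 g); rewrite raddf0 raddf_sum big_ord_recr /=.
rewrite raddfMz gE; have := iter_backward fv n 0; rewrite addn0 => -> rel.
have : v 0%N *~ P`_n \in torsion M.
  move/eqP: rel; rewrite addrC addr_eq0 => /eqP ->; rewrite rpredN.
  apply: rpred_sum => j _; rewrite raddfMz; apply: rpredMz.
  rewrite gE (iter_past_origin fv) //.
  by have [h <-] := iter_additive f (n - j.+1); exact: raddf_torsion.
rewrite torsionMz ?(negPf v0) //.
by have := lead_coef_eq0 P; rewrite lead_coefE sP /= -size_poly_eq0 sP => ->.
Qed.

(** Let [y] be the image of the string under the last power of [f] that does not
    kill [x 0].  If all [y n] are torsion, [0, y 0, y 1, ...] is a backward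
    orbit of torsion elements starting at [0].  Otherwise the first nontorsion
    [y n] starts a triangular sequence. *)
Lemma not_embedded_null :
  (forall p, prime p -> finite_set (p_component G p)) ->
  (rank0 G < +oo)%E -> ~ embedded null_string G.
Proof.
move=> fint rk0 [M [i [f [x [i_inj [[_ fx] x0 [k0 _ fk0]]]]]]].
have fintM p (pp : prime p) := p_component_finite_inj i_inj (fint p pp).
have exk : exists k, iter k f (x 0%N) == 0 by exists k0; apply/eqP.
have [[|k] /eqP fk k_min] := ex_minnP exk; first by apply: x0.
pose y n := iter k f (x n).
have fy n : f (y n.+1) = y n by rewrite /y -iterS iterSr fx.
have [yt|] := pselect (forall n, y n \in torsion M).
  suff : y 0%N = 0 by move/eqP/k_min; rewrite ltnn.
  apply: (torsion_backward_eq0 (f := f) fintM (x := fun n => if n is m.+1 then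
    y m else 0)
    _ _ _ 1%N) => // -[|n] //; first exact: rpred0.
move=> /existsNP[n0 /negP yn0].
have exn : exists n, y n \notin torsion M by exists n0.
have [n yn n_min] := ex_minnP exn.
suff rkoo : rank0 G = +oo%E by rewrite rkoo ltxx in rk0.
apply: (triangular_rank0 (f := f) (v := fun j => y (n + j)%N) i_inj).
- by move=> j; rewrite addnS.
- by rewrite addn0.
- rewrite addn0; case: n {yn} n_min => [|n] n_min;
  first by rewrite /y -iterS fk rpred0.
  by rewrite fy; apply: contraT => /n_min; rewrite ltnn.
Qed.

End NoStrings.

Theorem theorem7p6 (G : zmodType) :
  [/\ s_her G = 0%E <->
        (forall p : nat, prime p -> finite_set (p_component G p)) /\
        rank_le1_no_infinity (Quotient.quot (torsion G)),
      ns_her G = 0%E <->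
        (forall p : nat, prime p -> (rankp G p < +oo)%E) /\
        rank_le1_no_infinity (Quotient.quot (torsion G))
    & s0_her G = 0%E <->
        (forall p : nat, prime p -> finite_set (p_component G p)) /\
        (rank0 G < +oo)%E].
Proof.
have null_sub M f : null_string f `<=` @is_string M f by move=> x [].
have nonsing_sub M f : nonsingular_string f `<=` @is_string M f by move=> x [].
have socle_fin p : finite_set (p_component G p) -> finite_set (killed G p).
  by apply: sub_finite_set; exact: killed_sub_p_component.
split.
- apply: iff_trans (hereditary_number_eq0P is_string_stable G) _.
  split=> [noS|[fint rkG]]; last exact: not_embedded_string.
  have fint p : prime p -> finite_set (p_component G p).
    move=> pp; apply: contrapT => /(infinite_p_component_null pp).
    by move=> /(embedded_sub null_sub).
  split=> //; apply: contrapT => /rank_le1_fails_nonsingular h; apply: noS.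
  by apply/(embedded_sub nonsing_sub)/h => p pp; exact/socle_fin/fint.
- apply: iff_trans (hereditary_number_eq0P nonsingular_string_stable G) _.
  split=> [noS|[rkp rkG]].
    have finp p : prime p -> finite_set (killed G p).
      by move=> pp; apply: contrapT => /(infinite_killed_nonsingular pp).
    split=> [p pp|]; first exact/rankp_finiteP/finp.
    by apply: contrapT => /(rank_le1_fails_nonsingular finp).
  by apply: not_embedded_nonsingular rkG => p pp; apply/rankp_finiteP => //;
    exact: rkp.
- apply: iff_trans (hereditary_number_eq0P null_string_stable G) _.
  split=> [noS|[fint rk0]]; last exact: not_embedded_null.
  split=> [p pp|]; apply: contrapT;
    first by move=> /(infinite_p_component_null pp).
  by move=> /rank0_infinite_free_seq[e e_free]; apply: noS;
    exact: free_seq_null e_free.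
Qed.
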